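(* Let $b\in C^1([0,\infty))\cap L^\infty((0,\infty))$ and $m\in C([0,\infty))$ be real-valued, put $V(t):=m(t)-\frac12 b'(t)-\frac14[b(t)]^2$, and assume $V\in L^1((0,\infty))$. Let $M_V:=\|V\|_{L^1((0,\infty))}$ and let $\eta\geqslant\max\{1,16M_V\}$. Then there exists a unique $a_\eta\in C_b([0,\infty))$ satisfying, for every $t\geqslant 0$, $$a_\eta(t)=1-\frac{1}{2\eta}\int_t^\infty\big(1-\mathrm{e}^{-2\eta(s-t)}\big)V(s)a_\eta(s)\,\mathrm{d}s.$$ Moreover, $a_\eta\in C^2([0,\infty))$ fulfills $$\frac{30}{31}\leqslant a_\eta(t)\leqslant\frac{32}{31}\quad\text{for every } t\geqslant 0,$$ and $a_\eta$ solves $$a_\eta''(t)-2\eta a_\eta'(t)+V(t)a_\eta(t)=0$$ and satisfies $$\lim_{t\to\infty}a_\eta(t)=1\quad\text{and}\quad\lim_{t\to\infty}a_\eta'(t)=0.$$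
   Context: $C_b([0,\infty))$ denotes the space of bounded continuous real-valued functions on $[0,\infty)$. *)

(* Defs.v *)
From mathcomp Require Import all_boot all_order all_algebra.
From mathcomp Require Import all_classical all_reals all_analysis.

Set Implicit Arguments.
Unset Strict Implicit.
Unset Printing Implicit Defensive.

Import Order.TTheory GRing.Theory Num.Theory.
Import numFieldNormedType.Exports.

Local Open Scope classical_set_scope.
Local Open Scope ring_scope.

(** A function on [0, +oo[ is represented by a total function [R -> R] of
    which only the values on [0, +oo[ matter. *)
Definition halfline (R : realType) : set R := `[0, +oo[.

Definition open_halfline (R : realType) : set R := `]0, +oo[.

Arguments halfline {R}.
Arguments open_halfline {R}.

Section HalfLine.
Context {R : realType}.
Implicit Types (f b m a : R -> R) (t eta : R).

(** The limit is taken along the points of [0, +oo[ different from [t], so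
    that this is the usual derivative at [t > 0] and the right derivative at
    [t = 0]. *)
Definition diff_quot f t : R -> R := fun s => (f s - f t) / (s - t).

Definition hderivable f t : Prop :=
  cvg (diff_quot f t s @[s --> within halfline t^']).

Definition hderive f t : R :=
  lim (diff_quot f t s @[s --> within halfline t^']).

(** [C^k([0, +oo[)], with a one-sided derivative at 0. *)
Definition hC (k : nat) f : Prop :=
  (forall i t, (i < k)%N -> 0 <= t -> hderivable (iter i hderive f) t) /\
  (forall i, (i <= k)%N -> {within halfline, continuous (iter i hderive f)}).

Definition hCb f : Prop :=
  {within halfline, continuous f} /\ [bounded f t | t in halfline].

(** [L^p(]0, +oo[)] is identified with the functions whose extension by 0 is in
    [L^p(R)], with the same norm. *)
Definition hLfun (p : \bar R) f : Prop :=
  (f \_ open_halfline) \in Lfun lebesgue_measure p.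

Definition hL1norm f : R :=
  fine (Lnorm lebesgue_measure 1%E (EFin \o (f \_ open_halfline))).

Definition potential b m t : R :=
  m t - 2^-1 * hderive b t - 4^-1 * b t ^+ 2.

Definition volterra_eq (V : R -> R) eta a : Prop :=
  forall t, 0 <= t ->
    a t = 1 - (2 * eta)^-1 *
      \int[lebesgue_measure]_(s in `[t, +oo[)
        ((1 - expR (- (2 * eta * (s - t)))) * V s * a s).

End HalfLine.

(* Main.v *)
Require Import Defs.
From mathcomp Require Import all_boot all_order all_algebra.
From mathcomp Require Import all_classical all_reals all_analysis.
From mathcomp Require Import measurable_realfun ring lra.

Set Implicit Arguments.
Unset Strict Implicit.
Unset Printing Implicit Defensive.

Import Order.TTheory GRing.Theory Num.Theory.
Import numFieldNormedType.Exports.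

Local Open Scope classical_set_scope.
Local Open Scope ring_scope.

(** With [c = 2 eta], the right-hand side of the integral equation is
    [1 - c^-1 * (T (V a) t - w t)], where [T g t] is the integral of [g] over
    [[t, +oo[] and [w t = e^(c t) T (e^(-c s) V a) t]. Since the kernel
    [1 - e^(-c (s - t))] lies in [[0, 1]], this operator contracts the
    sup-distance by the factor [M_V / c <= 1 / 32], which gives the unique fixed
    point; comparing it with the value [1] of the operator at [0] gives the
    bound [|a - 1| <= 1 / 31] and the limit of [a]. The fundamental theorem of
    calculus for [T] yields [a' = w] and [w' = c w - V a], hence the
    regularity, the differential equation, and
    [|a' t| <= sup |a| * T |V| t --> 0]. To have two-sided derivatives also at
    [0], [V] is extended to negative arguments by the constant [V 0]. *)

(** * Geometric error estimates and contractions of bounded continuous functions *)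

(** Closes every argument that applies a contraction [n] times: the fixed-point equation, uniqueness
    and the bound 32/31. *)
Lemma le_geometric_error (R : realType) (C q x y : R) :
  0 <= q -> q < 1 -> (forall n, x <= y + C * q ^+ n) -> x <= y.
Proof.
move=> q0 q1 xy.
have qc : y + geometric C q n @[n --> \oo] --> y + 0.
  by apply: cvgD; [exact: cvg_cst|apply: cvg_geometric; rewrite ger0_norm].
rewrite addr0 in qc; rewrite -(cvg_lim _ qc)//.
apply: limr_ge; first by apply/cvg_ex; exists y.
exact: nearW.
Qed.

(* The limit is the common point of the nested intervals of centre [u n] and
   radius [C / (1 - q) * q ^+ n]. *)
Lemma geometric_limit (R : realType) (u : nat -> R) (C q : R) :
  0 <= q -> q < 1 -> (forall n, `|u n.+1 - u n| <= C * q ^+ n) ->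
  exists l, forall n, `|u n - l| <= C / (1 - q) * q ^+ n.
Proof.
move=> q0 q1 du; set D := C / (1 - q).
have DC : C = D * (1 - q) by rewrite /D divfK// subr_eq0 eq_sym lt_eqF.
have D0 : 0 <= D.
  have := du 0%N; rewrite expr0 mulr1 => /(le_trans (normr_ge0 _)).
  by rewrite DC pmulr_lge0// subr_gt0.
(* Since [C * q ^+ n = D * q ^+ n - D * q ^+ n.+1], a step of [u] is at most the decrease of the
   radius, so lower ends increase and upper ends decrease. *)
have lo : {homo (fun n => u n - D * q ^+ n) : n m / (n <= m)%N >-> n <= m}.
  apply/nondecreasing_seqP => n; have := du n.
  rewrite DC ler_norml exprS => /andP[] A _; lra.
have hi : {homo (fun n => u n + D * q ^+ n) : n m / (n <= m)%N >-> m <= n}.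
  apply/nonincreasing_seqP => n; have := du n.
  rewrite DC ler_norml exprS => /andP[] _ A; lra.
have nest n m : u n - D * q ^+ n <= u m + D * q ^+ m.
  apply: (le_trans (lo _ _ (leq_maxl n m))).
  apply: (le_trans _ (hi _ _ (leq_maxr n m))).
  have : 0 <= D * q ^+ maxn n m by rewrite mulr_ge0// exprn_ge0.
  lra.
pose E := range (fun n => u n - D * q ^+ n).
exists (sup E) => n.
have : u n - D * q ^+ n <= sup E.
  apply: ub_le_sup; last by exists n.
  by exists (u 0%N + D * q ^+ 0) => _ [k _ <-]; exact: nest.
have : sup E <= u n + D * q ^+ n.
  apply: ge_sup; first by exists (u n - D * q ^+ n), n.
  by move=> _ [k _ <-]; exact: nest.
by rewrite ler_norml => ? ?; apply/andP; split; lra.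
Qed.

(** Posed on all of [R], so that continuity is two-sided at 0 too; functions on the half-line enter
    through composition with [Num.max t 0]. *)
Definition bounded_continuous {R : realType} (f : R -> R) : Prop :=
  continuous f /\ exists C, forall x, `|f x| <= C.

Lemma bounded_continuous_cst (R : realType) (x : R) :
  bounded_continuous (fun=> x : R).
Proof.
by split; [move=> y; exact: cvg_cst|exists `|x| => y].
Qed.

(** Banach iteration from 0. The contraction is phrased with an arbitrary uniform bound [C] in place
    of a sup norm: limits are taken pointwise, but the error [D * q ^+ n] does not depend on the
    point, which makes the limit continuous and bounded. *)
Lemma bounded_continuous_fixpoint (R : realType) (q : R)
    (T : (R -> R) -> R -> R) :
  0 <= q -> q < 1 ->
  (forall f, bounded_continuous f -> bounded_continuous (T f)) ->
  (forall f g C, bounded_continuous f -> bounded_continuous g ->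
    (forall x, `|f x - g x| <= C) -> forall x, `|T f x - T g x| <= q * C) ->
  exists2 f, bounded_continuous f & forall x, T f x = f x.
Proof.
move=> q0 q1 Tbc Tq.
pose u := fix u n := if n is k.+1 then T (u k) else fun=> 0.
have ubc n : bounded_continuous (u n).
  by elim: n => [|n IH]; [exact: bounded_continuous_cst|exact: Tbc].
have [C HC] : exists C, forall x, `|u 1%N x - u 0%N x| <= C.
  have [_ [C HC]] := ubc 1%N.
  by exists C => x; rewrite [u 0%N x]/= subr0.
have du n x : `|u n.+1 x - u n x| <= C * q ^+ n.
  elim: n x => [|n IH] x; first by rewrite expr0 mulr1; exact: HC.
  by rewrite exprS mulrCA; exact: (Tq _ _ _ (ubc n.+1) (ubc n)).
set D := C / (1 - q).
have /choice[f fu] : forall x, exists l, forall n, `|u n x - l| <= D * q ^+ n.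
  by move=> x; apply: geometric_limit => // n; exact: du.
have qn0 (e : R) : 0 < e -> \forall n \near \oo, D * q ^+ n < e.
  move=> e0.
  have : geometric D q n @[n --> \oo] --> (0 : R).
    by apply: cvg_geometric; rewrite ger0_norm.
  move=> /cvgr0Pnorm_lt /(_ _ e0); apply: filterS => n.
  by apply: le_lt_trans; exact: ler_norm.
have fbc : bounded_continuous f.
  split.
    move=> x; apply/cvgrPdist_lt => e e0.
    have [n _ /(_ n (leqnn n)) /= ne] := qn0 (e / 3) (divr_gt0 e0 (ltr0n _ 3)).
    have [cu _] := ubc n.
    have /cvgrPdist_lt /(_ (e / 3) (divr_gt0 e0 (ltr0n _ 3))) := cu x.
    apply: filterS => y uxy.
    have -> : f x - f y = (f x - u n x) + (u n x - u n y) + (u n y - f y).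
      by lra.
    apply: (le_lt_trans (ler_normD _ _)).
    have := ler_normD (f x - u n x) (u n x - u n y).
    have := fu x n; have := fu y n; rewrite (distrC (f x)) => ? ? ?; lra.
  have [_ [B HB]] := ubc 0%N.
  exists (B + D) => x; have := fu x 0%N; rewrite expr0 mulr1 => H.
  have := ler_normB (u 0%N x) (u 0%N x - f x).
  by rewrite opprB addrCA subrr addr0 => /le_trans; apply; exact: lerD.
exists f => // x; apply/eqP; rewrite -subr_eq0 -normr_le0.
(* [T f] and [f] are both within [D * q ^+ n.+1] of [u n.+1 = T (u n)], hence the factor 2. *)
apply: (@le_geometric_error _ (2 * (q * D)) q) => // n.
have := Tq _ _ _ (ubc n) fbc (fun x => fu x n) x.
have := fu x n.+1; rewrite exprS /= => A B.
have -> : T f x - f x = (T (u n) x - f x) - (T (u n) x - T f x) by lra.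
by apply: (le_trans (ler_normB _ _)); lra.
Qed.

(** * Tail integrals: bounds, derivative, limit at infinity *)

Section tail.
Context {R : realType}.
Local Notation mu := (@lebesgue_measure R).
Implicit Types (g h : R -> R) (t C : R).

Definition tail g t : R := \int[mu]_(s in `[t, +oo[) g s.

Lemma measurable_halfline : measurable (@halfline R).
Proof. exact: measurable_itv. Qed.

Lemma integrable_halfline_sub g t : 0 <= t ->
  mu.-integrable halfline (EFin \o g) -> mu.-integrable `[t, +oo[ (EFin \o g).
Proof.
move=> t0 ig; apply: (integrableS _ _ _ ig); rewrite /halfline //.
by move=> s /=; rewrite !in_itv/= !andbT; exact: le_trans.
Qed.

Lemma integrable_mul_bounded g h t C : continuous g -> continuous h ->
  mu.-integrable `[t, +oo[ (EFin \o g) -> (forall s, t <= s -> `|h s| <= C) ->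
  mu.-integrable `[t, +oo[ (EFin \o (fun s => g s * h s)).
Proof.
move=> cg ch ig hC.
apply: (le_integrable _ _ _ (integrableZl _ C ig)) => //.
- apply/measurable_EFinP; apply: measurable_funTS.
  by apply: measurable_funM; exact: continuous_measurable_fun.
- move=> s /=; rewrite in_itv/= andbT => /hC hs.
  rewrite lee_fin !normrM mulrC ler_wpM2r//.
  by rewrite (le_trans hs)// ler_norm.
Qed.

Lemma normr_tail_mul_le g h t C : continuous g -> continuous h ->
  mu.-integrable `[t, +oo[ (EFin \o g) -> (forall s, t <= s -> `|h s| <= C) ->
  `|tail (fun s => g s * h s) t| <= C * tail (fun s => `|g s|) t.
Proof.
move=> cg ch ig hC; rewrite /tail.
have igh := integrable_mul_bounded cg ch ig hC.
apply: (le_trans (le_normr_Rintegral _ igh)) => //.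
have ing := integrable_norm ig.
rewrite -RintegralZl//; apply: le_Rintegral => //.
- exact: integrable_norm igh.
- exact: (integrableZl _ _ ing).
- move=> s /=; rewrite in_itv/= andbT => /hC hs.
  by rewrite normrM mulrC ler_wpM2r.
Qed.

Lemma tail_le g s t : (forall x, 0 <= g x) -> s <= t ->
  mu.-integrable `[s, +oo[ (EFin \o g) -> tail g t <= tail g s.
Proof.
move=> g0 st ig.
have sub : `[t, +oo[ `<=` `[s, +oo[.
  by move=> x /=; rewrite !in_itv/= !andbT; exact: le_trans.
rewrite /tail fine_le//.
- by apply: integrable_fin_num => //; exact: integrableS ig.
- exact: integrable_fin_num.
- apply: ge0_subset_integral => //; first by case/integrableP: ig.
  by move=> x _; rewrite lee_fin.
Qed.

(** Near [t] the tail is a constant minus the primitive of [g] based at -1. The base point lies left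
    of 0, so the fundamental theorem of calculus gives a two-sided derivative even at [t = 0]. *)
Lemma tail_is_derive g t : continuous g ->
  mu.-integrable halfline (EFin \o g) -> 0 <= t ->
  is_derive t (1 : R) (tail g) (- g t).
Proof.
move=> cg ig t0.
(* The piece added to the half-line lies in the compact interval [[-1, 0]], where continuity gives
   integrability. *)
have igy : mu.-integrable `[-1, +oo[ (EFin \o g).
  rewrite (@itv_bndbnd_setU _ _ _ (BLeft 0))//; last by rewrite bnd_simp.
  have mg (D : set R) : measurable_fun D (EFin \o g).
    apply/measurable_EFinP; apply: measurable_funTS.
    exact: continuous_measurable_fun.
  have /integrableP[_ ig1] : mu.-integrable `[-1, 0] (EFin \o g).
    apply: continuous_compact_integrable; first exact: segment_compact.
    exact: continuous_subspaceT.
  have /integrableP[_ ig0] := ig.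
  apply/integrableP; split; first exact: mg.
  rewrite ge0_integral_setU//.
  - rewrite lte_add_pinfty//; apply: le_lt_trans ig1.
    apply: ge0_subset_integral => //.
      by apply: measurableT_comp => //; exact: mg.
    by move=> x /=; rewrite !in_itv/= => /andP[-> /ltW].
  - by apply: measurableT_comp => //; exact: mg.
  - apply/disj_setPS => y [/=]; rewrite !in_itv/= andbT => /andP[_ y0].
    by rewrite leNgt y0.
pose F (y : R) : R := \int[mu]_(s in `[-1, y]) g s.
have tFE (y : R) : -1 <= y -> tail g y = tail g (-1) - F y.
  move=> y1; rewrite /tail Rintegral_itvB//.
  rewrite Rintegral_itv_obnd_cbnd//.
  apply: integrableS igy => // x /=; rewrite !in_itv/= !andbT => /ltW.
  exact: le_trans.
have [dF F't] : derivable F t 1 /\ F^`()%classic t = g t.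
  apply: (@continuous_FTC1_closed _ _ _ _ (t + 1)) => //.
  - by rewrite ltrDl.
  - apply: integrableS igy => //; exact: subset_itvl.
  - lra.
  - exact: cg.
apply: (@near_eq_is_derive _ _ _ (fun y => tail g (-1) - F y)).
  have : \forall y \near t, -1 < y by apply: lt_nbhsr; lra.
  by apply: filterS => y /ltW y1; rewrite (tFE y).
have dF' : is_derive t (1 : R) F (g t) :=
  DeriveDef dF (etrans (esym (derive1E F t)) F't).
rewrite -[- g t]add0r.
exact: (is_deriveB (is_derive_cst (tail g (-1)) t 1) dF').
Qed.

(** Dominated convergence, with [g] itself as dominating function, settles integer [t]; monotonicity
    of the tail extends this to real [t]. *)
Lemma tail_cvg0 g : (forall x, 0 <= g x) ->
  mu.-integrable halfline (EFin \o g) -> tail g t @[t --> +oo] --> (0 : R).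
Proof.
move=> g0 ig.
have cvgn : tail g n%:R @[n --> \oo] --> (0 : R).
  pose f_ n (x : R) : \bar R := ((EFin \o g) \_ `[n%:R, +oo[ x)%E.
  have fint n : (\int[mu]_(x in halfline) f_ n x = (tail g n%:R)%:E)%E.
    rewrite /f_ -integral_mkcondr.
    have -> : halfline `&` `[n%:R, +oo[ = `[n%:R : R, +oo[%classic.
      rewrite /halfline; apply/seteqP; split=> [x [//]|x /=].
      rewrite !in_itv/= !andbT => nx; split=> //.
      by apply: le_trans nx; exact: ler0n.
    rewrite /tail fineK//; apply: integrable_fin_num => //.
    exact: integrable_halfline_sub.
  have mf n : measurable_fun halfline (f_ n).
    apply/measurable_restrict => //; first exact: measurable_halfline.
    apply: (@measurable_funS _ _ _ _ halfline).
    - exact: measurable_halfline.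
    - by move=> x [].
    - by case/integrableP: ig.
  have f0 x : halfline x -> f_ n x @[n --> \oo] --> cst 0%E x.
    (* For fixed [x] the truncation vanishes as soon as [n] exceeds [x]. *)
    move=> x0; apply: cvg_near_cst.
    have := nbhs_infty_gtr x; apply: filterS => n xn.
    rewrite /f_ patchE ifF//; apply/negbTE; rewrite notin_setE/= in_itv/= andbT.
    by apply/negP; rewrite -ltNge.
  have fg n x : halfline x -> (`|f_ n x| <= (EFin \o g) x)%E.
    move=> x0; rewrite /f_ patchE; case: ifPn => _ /=.
      by rewrite ger0_norm.
    by rewrite normr0 lee_fin.
  have := @dominated_cvg _ _ _ mu _ measurable_halfline _ (cst 0%E) _
    mf f0 _ ig fg.
  by rewrite integral0 (eq_cvg _ _ fint) => /(_ (fun _ _ => isT))/fine_cvg.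
apply/cvgrPdist_lt => e e0.
move/cvgr0Pnorm_lt : cvgn => /(_ e e0) [n _ /(_ n (leqnn n)) /= ne].
near=> t; rewrite sub0r normrN.
apply: le_lt_trans ne; rewrite !ger0_norm ?Rintegral_ge0//.
apply: tail_le => //.
exact: integrable_halfline_sub.
Unshelve. all: by end_near.
Qed.

End tail.

(** * Continuity and derivatives on the closed half-line *)

Section halfline_calculus.
Context {R : realType}.
Implicit Types (f F : R -> R) (t l : R).

Lemma continuous_maxr0 : continuous (fun t : R => Num.max t 0).
Proof.
move=> t; apply: (@continuous_max R R id (cst 0)).
  exact: cvg_id.
exact: cvg_cst.
Qed.

Lemma continuous_comp_maxr0 f : {within halfline, continuous f} ->
  continuous (fun t => f (Num.max t 0)).
Proof.
move=> /subspace_continuousP cf t U /= fU.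
have h0 (s : R) : halfline (Num.max s 0).
  by rewrite /halfline/= in_itv/= andbT le_max lexx orbT.
have := continuous_maxr0 (cf _ (h0 t) _ fU).
by apply: (@filterS _ (nbhs t)) => s; apply; exact: h0.
Qed.

(** Points to the right of [t] stay in the half-line, even for [t = 0]. Properness makes limits
    unique, so that the [lim] in [hderive] can be computed. *)
Lemma within_halfline_proper t : 0 <= t ->
  ProperFilter (within halfline t^').
Proof.
move=> t0; split; last exact: within_filter.
rewrite /within/= => -[e /= e0] /(_ (t + e / 2)); rewrite /ball_/= => H.
apply: H.
- rewrite opprD addNKr normrN ger0_norm; lra.
- by rewrite gt_eqF//; lra.
- rewrite /halfline/= in_itv/= andbT; lra.
Qed.

Lemma diff_quot_cvg f F t l : 0 <= t -> (forall s, 0 <= s -> f s = F s) ->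
  is_derive t (1 : R) F l ->
  diff_quot f t s @[s --> within halfline t^'] --> l.
Proof.
move=> t0 fF [/cvg_ex[l' dF] Fl].
have {Fl} <- : l' = l by rewrite -Fl; apply/esym/cvg_lim.
apply/cvgrPdist_lt => e e0.
move/cvgrPdist_lt : dF => /(_ _ e0) [d /= d0 H].
exists d => //= s; rewrite /ball_/= => std st.
rewrite /halfline/= in_itv/= andbT => s0.
have := H (s - t); rewrite /ball_/= sub0r normrN distrC => /(_ std).
rewrite subr_eq0 => /(_ st).
rewrite /= [X in F (X + _)]mulr1 subrK => Hs.
by rewrite /diff_quot !fF// mulrC; exact: Hs.
Qed.

(** Carries two-sided derivatives over to [hderive]: restricting the filter keeps the limit, and the
    values of [f] at negative points are never consulted. *)
Lemma hderivableE f F t l : 0 <= t -> (forall s, 0 <= s -> f s = F s) ->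
  is_derive t (1 : R) F l -> hderivable f t /\ hderive f t = l.
Proof.
move=> t0 fF dF; have fl := diff_quot_cvg t0 fF dF.
have pf := within_halfline_proper t0.
split; first by apply/cvg_ex; exists l.
exact: cvg_lim.
Qed.

Lemma within_halfline_continuous f F : (forall s, 0 <= s -> f s = F s) ->
  (forall t, 0 <= t -> {for t, continuous F}) ->
  {within halfline, continuous f}.
Proof.
move=> fF cF; apply/subspace_continuousP => t.
rewrite /halfline/= in_itv/= andbT => t0 U fU.
have FU : nbhs (F t) U by rewrite -fF.
have := cF t t0 _ FU; apply: (@filterS _ (nbhs t)) => s Us.
by rewrite /= in_itv/= andbT => s0; suff : U (f s) by []; rewrite fF.
Qed.

End halfline_calculus.

(** * The integral operator: estimates, derivatives, fixed point *)

Section volterra.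
Context {R : realType} (W : R -> R) (M c : R).
Local Notation mu := (@lebesgue_measure R).
Context (W_cont : continuous W)
        (W_int : mu.-integrable halfline (EFin \o W))
        (W_tail : tail (fun s => `|W s|) 0 <= M)
        (c_gt0 : 0 < c).
Implicit Types (f g : R -> R) (t C : R).

Definition weighted_tail f t : R :=
  expR (c * t) * tail (fun s => W s * (expR (- (c * s)) * f s)) t.

(** Splitting the kernel and pulling [expR (c * t)] out removes [t] from both integrands, so each
    tail can be differentiated by [tail_is_derive]. [volterra_opE] restores the kernel form for
    estimates. *)
Definition volterra_op f t : R :=
  1 - c^-1 * (tail (fun s => W s * f s) t - weighted_tail f t).

Let W_intt t : 0 <= t -> mu.-integrable `[t, +oo[ (EFin \o W).
Proof. by move=> t0; exact: integrable_halfline_sub. Qed.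

Lemma continuous_expR_affine (k l : R) : continuous (fun s => expR (k * s + l)).
Proof.
move=> s; apply: continuous_comp; last exact: continuous_expR.
apply: cvgD; last exact: cvg_cst.
by apply: cvgM; [exact: cvg_cst|exact: cvg_id].
Qed.

Lemma continuous_decay t : continuous (fun s => expR (- (c * (s - t)))).
Proof.
have -> : (fun s => expR (- (c * (s - t)))) = (fun s => expR (- c * s + c * t)).
  by apply/funext => s; congr expR; ring.
exact: continuous_expR_affine.
Qed.

Lemma decay_le1 s t : t <= s -> expR (- (c * (s - t))) <= 1.
Proof.
move=> ts; rewrite -expR0 ler_expR oppr_le0 mulr_ge0//; first exact: ltW.
by rewrite subr_ge0.
Qed.

Lemma bounded_continuous_decay f : bounded_continuous f ->
  continuous (fun s => expR (- (c * s)) * f s) /\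
  exists C, forall s, 0 <= s -> `|expR (- (c * s)) * f s| <= C.
Proof.
move=> [cf [C fC]]; split.
  move=> s; apply: cvgM; last exact: cf.
  have := @continuous_decay 0 s.
  by under eq_fun do rewrite subr0.
exists C => s s0; rewrite normrM ger0_norm ?expR_ge0//.
rewrite -[leRHS]mul1r ler_pM ?expR_ge0//.
by have := decay_le1 s0; rewrite subr0.
Qed.

(** Once the growing factor is back under the integral, the weight is at most 1 on the domain of
    integration; the bounds on [weighted_tail] rest on this form. *)
Lemma weighted_tailE f t : bounded_continuous f -> 0 <= t ->
  weighted_tail f t = tail (fun s => W s * (expR (- (c * (s - t))) * f s)) t.
Proof.
move=> fbc t0; have [cf [C fC]] := bounded_continuous_decay fbc.
rewrite /weighted_tail /tail -RintegralZl//.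
  apply: eq_Rintegral => s _; rewrite mulrCA; congr (_ * _).
  by rewrite mulrA -expRD; congr (expR _ * _); ring.
apply: (integrable_mul_bounded (C := C)) => //; first exact: W_intt.
by move=> s ts; apply: fC; exact: le_trans ts.
Qed.

Lemma volterra_opE f t : bounded_continuous f -> 0 <= t ->
  volterra_op f t =
    1 - c^-1 * tail (fun s => (1 - expR (- (c * (s - t)))) * W s * f s) t.
Proof.
move=> fbc t0; rewrite /volterra_op weighted_tailE//.
congr (_ - _ * _); rewrite /tail -RintegralB//.
- by apply: eq_Rintegral => s _; ring.
- have [cf [C fC]] := fbc.
  by apply: (integrable_mul_bounded (C := C)) => //; exact: W_intt.
- have [cf [C fC]] := fbc.
  apply: (integrable_mul_bounded (C := C)) => //; last 1 first.
  + move=> s ts; rewrite normrM ger0_norm ?expR_ge0//.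
    by rewrite -[leRHS]mul1r ler_pM ?expR_ge0// decay_le1.
  + by move=> s; apply: cvgM; [exact: continuous_decay|exact: cf].
  + exact: W_intt.
Qed.

Lemma weighted_tail_le f t C : bounded_continuous f -> 0 <= t ->
  (forall s, `|f s| <= C) ->
  `|weighted_tail f t| <= C * tail (fun s => `|W s|) t.
Proof.
move=> fbc t0 fC; rewrite weighted_tailE//.
apply: normr_tail_mul_le => //; last 1 first.
- move=> s ts; rewrite normrM ger0_norm ?expR_ge0//.
  by rewrite -[leRHS]mul1r ler_pM ?expR_ge0// decay_le1.
- have [cf _] := fbc.
  by move=> s; apply: cvgM; [exact: continuous_decay|exact: cf].
- exact: W_intt.
Qed.

(** The kernel lies in [[0, 1]]. Keeping the tail of [|W|] at [t], and not just its bound [M], lets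
    the estimate serve both the contraction and the limit at infinity. *)
Lemma volterra_opB_le f g t C : bounded_continuous f -> bounded_continuous g ->
  0 <= t -> (forall s, 0 <= s -> `|f s - g s| <= C) ->
  `|volterra_op f t - volterra_op g t| <=
    c^-1 * (C * tail (fun s => `|W s|) t).
Proof.
move=> fbc gbc t0 fgC.
pose k s := (1 - expR (- (c * (s - t)))).
have ck : continuous k.
  by move=> s; apply: cvgB; [exact: cvg_cst|exact: continuous_decay].
have k01 s : t <= s -> `|k s| <= 1.
  move=> /decay_le1; have := expR_ge0 (- (c * (s - t))); rewrite /k.
  by move: (expR _) => e e0 e1; rewrite ger0_norm; lra.
have kint h : bounded_continuous h ->
    mu.-integrable `[t, +oo[ (EFin \o (fun s => (k s * W s * h s))).
  move=> [ch [D hD]].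
  have -> : (fun s => k s * W s * h s) = (fun s => W s * (k s * h s)).
    by apply/funext => s; ring.
  apply: (integrable_mul_bounded (C := D)) => //; last 1 first.
  - by move=> s ts; rewrite normrM -[leRHS]mul1r ler_pM// k01.
  - by move=> s; apply: cvgM; [exact: ck|exact: ch].
  - exact: W_intt.
rewrite !volterra_opE//.
have -> : forall x y : R, 1 - c^-1 * x - (1 - c^-1 * y) = - (c^-1 * (x - y)).
  by move=> x y; ring.
rewrite normrN normrM ger0_norm ?invr_ge0 ?(ltW c_gt0)//.
rewrite ler_wpM2l ?invr_ge0 ?(ltW c_gt0)//.
rewrite /tail -RintegralB//; [|exact: kint..].
under eq_Rintegral do rewrite -mulrBr mulrAC mulrC.
apply: normr_tail_mul_le => //; last 1 first.
- move=> s ts; rewrite normrM -[leRHS]mul1r ler_pM// ?k01// fgC//.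
  exact: le_trans ts.
- move=> s; apply: cvgM; first exact: ck.
  by apply: cvgB; [exact: fbc.1|exact: gbc.1].
- exact: W_intt.
Qed.

(** The product rule gives the second derivative, as [expR (c * t)] cancels the weight at the
    endpoint. In the first, the two endpoint terms [W t * f t] cancel, leaving [weighted_tail],
    which is itself differentiable. *)
Lemma volterra_op_is_derive f t : bounded_continuous f -> 0 <= t ->
  is_derive t (1 : R) (volterra_op f) (weighted_tail f t) /\
  is_derive t (1 : R) (weighted_tail f) (c * weighted_tail f t - W t * f t).
Proof.
move=> fbc t0; have [cf [C fC]] := fbc.
have [ce [D eD]] := bounded_continuous_decay fbc.
have d1 : is_derive t (1 : R) (tail (fun s => W s * f s)) (- (W t * f t)).
  apply: tail_is_derive => //.
    by move=> s; apply: cvgM; [exact: W_cont|exact: cf].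
  by apply: (integrable_mul_bounded (C := C)).
have d2 : is_derive t (1 : R)
    (tail (fun s => W s * (expR (- (c * s)) * f s)))
    (- (W t * (expR (- (c * t)) * f t))).
  apply: (@tail_is_derive _ (fun s => W s * (expR (- (c * s)) * f s))) => //.
    by move=> s; apply: cvgM; [exact: W_cont|exact: ce].
  by apply: (integrable_mul_bounded (C := D)).
have de : is_derive t (1 : R) (fun s => expR (c * s)) (c * expR (c * t)).
  have dc : is_derive t (1 : R) (fun s : R => c * s) c.
    have := is_deriveZ c (is_derive_id t (1 : R)).
    by rewrite /GRing.scale/= mulr1.
  rewrite mulrC; exact: (is_derive1_comp (is_derive_expR _) dc).
have dw : is_derive t (1 : R) (weighted_tail f)
    (c * weighted_tail f t - W t * f t).
  apply: is_derive_eq (is_deriveM de d2) _.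
  rewrite /GRing.scale/= /weighted_tail.
  have : expR (c * t) * expR (- (c * t)) = 1 by rewrite -expRD subrr expR0.
  set p := expR (c * t); set q := expR _; set T := tail _ _ => pq.
  transitivity (c * (p * T) - (p * q) * (W t * f t)); last by rewrite pq mul1r.
  ring.
split => //.
(* The value is rewritten in the shape that the differentiation rules produce. *)
have -> : weighted_tail f t =
    0 - c^-1 * (- (W t * f t) - (c * weighted_tail f t - W t * f t)).
  by field; rewrite gt_eqF.
exact: (is_deriveB (is_derive_cst (1 : R) t (1 : R))
  (is_deriveZ c^-1 (is_deriveB d1 dw))).
Qed.

Lemma continuous_volterra_op f t : bounded_continuous f -> 0 <= t ->
  {for t, continuous (volterra_op f)}.
Proof.
move=> fbc t0; have [[d _] _] := volterra_op_is_derive fbc t0.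
by apply: differentiable_continuous; apply/derivable1_diffP.
Qed.

Lemma tail_normr_le t : 0 <= t -> tail (fun s => `|W s|) t <= M.
Proof.
move=> t0; apply: le_trans W_tail; apply: tail_le => //.
exact: integrable_norm.
Qed.

Lemma volterra_op0 t : volterra_op (fun=> 0) t = 1.
Proof.
rewrite /volterra_op /weighted_tail /tail.
under eq_Rintegral do rewrite mulr0.
under [X in expR _ * X]eq_Rintegral do rewrite !mulr0.
by rewrite Rintegral_cst// mul0r mulr0 subrr mulr0 subr0.
Qed.

Context (cM : 32 * M <= c).

Lemma volterra_op_contraction f g t C :
  bounded_continuous f -> bounded_continuous g -> 0 <= t ->
  (forall s, 0 <= s -> `|f s - g s| <= C) ->
  `|volterra_op f t - volterra_op g t| <= 32^-1 * C.
Proof.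
move=> fbc gbc t0 fgC; apply: (le_trans (volterra_opB_le fbc gbc t0 fgC)).
have C0 : 0 <= C by apply: le_trans (fgC 0 (lexx _)).
rewrite ler_pdivrMl// mulrA [leRHS]mulrC; apply: ler_wpM2l => //.
by apply: (le_trans (tail_normr_le t0)); rewrite ler_pdivlMr// mulrC.
Qed.

(** Evaluating the operator at [Num.max t 0] turns it into a self-map of bounded continuous
    functions on [R], unchanged for [t >= 0]. *)
Lemma volterra_fixpoint_exists : exists2 a, bounded_continuous a &
  forall t, 0 <= t -> a t = volterra_op a t.
Proof.
have max0 (t : R) : 0 <= Num.max t 0 by rewrite le_max lexx orbT.
have zbc := bounded_continuous_cst (0 : R).
have [||f fbc|f g C fbc gbc fgC x|a abc fix_a] :=
    @bounded_continuous_fixpoint R 32^-1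
      (fun f t => volterra_op f (Num.max t 0)).
- by lra.
- by lra.
- split.
    move=> t; apply: (@continuous_comp _ _ _ (fun t => Num.max t 0)).
      exact: continuous_maxr0.
    exact: continuous_volterra_op.
  (* Contraction against the zero function, whose image is 1. *)
  have [_ [C fC]] := fbc; exists (32^-1 * C + 1) => t.
  have -> : volterra_op f (Num.max t 0) =
      (volterra_op f (Num.max t 0) - volterra_op (fun=> 0) (Num.max t 0)) + 1.
    by rewrite volterra_op0 subrK.
  apply: (le_trans (ler_normD _ _)); rewrite normr1 lerD2r.
  by apply: volterra_op_contraction => // s _; rewrite subr0.
- by apply: volterra_op_contraction => // s _; exact: fgC.
- by exists a => // t t0; rewrite -[LHS]fix_a max_l.
Qed.

(** Starting from the crude bound [C' + C], each use of the two fixed-point equations gains a factor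
    1/32 in the difference on the half-line. *)
Lemma volterra_fixpoint_unique a a' :
  bounded_continuous a -> bounded_continuous a' ->
  (forall t, 0 <= t -> a t = volterra_op a t) ->
  (forall t, 0 <= t -> a' t = volterra_op a' t) ->
  forall t, 0 <= t -> a' t = a t.
Proof.
move=> abc a'bc fix_a fix_a' t t0.
have [_ [C aC]] := abc; have [_ [C' a'C]] := a'bc.
apply/eqP; rewrite -subr_eq0 -normr_le0.
apply: (@le_geometric_error _ (C' + C) 32^-1) => [||n]; [lra|lra|].
rewrite add0r; elim: n t t0 => [|n IH] t t0.
  by rewrite expr0 mulr1 (le_trans (ler_normB _ _))// lerD.
rewrite exprS mulrCA fix_a' // fix_a //.
exact: volterra_op_contraction.
Qed.

Section fixpoint.
Context (a : R -> R) (abc : bounded_continuous a)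
        (fix_a : forall t, 0 <= t -> a t = volterra_op a t).

Lemma volterra_fixpoint_bounds t : 0 <= t -> 30 / 31 <= a t <= 32 / 31.
Proof.
have [_ [C aC]] := abc.
have zbc := bounded_continuous_cst (0 : R).
have step D s : 0 <= s -> (forall x, 0 <= x -> `|a x| <= D) ->
    `|a s - 1| <= 32^-1 * D.
  move=> s0 aD; rewrite fix_a// -[X in _ - X](volterra_op0 s).
  by apply: volterra_op_contraction => // x x0; rewrite subr0 aD.
have C0 : 0 <= C by apply: le_trans (aC 0).
(* 32/31 is the fixed point of [D |-> 1 + D / 32], the improvement of a bound [D] on [|a|] that
   [step] provides; a last [step] from 32/31 gives [|a - 1| <= 1/31]. *)
have aleC n s : 0 <= s -> `|a s| <= 32 / 31 + C * 32^-1 ^+ n.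
  elim: n s => [|n IH] s s0.
    by rewrite expr0 mulr1; apply: (le_trans (aC s)); lra.
  have := step _ _ s0 IH; rewrite exprS.
  have := ler_normD (a s - 1) 1; rewrite subrK normr1.
  lra.
have ale s : 0 <= s -> `|a s| <= 32 / 31.
  move=> s0; apply: (@le_geometric_error _ C 32^-1) => [||n]; [lra|lra|].
  exact: aleC.
by move=> t0; have := step _ _ t0 ale; rewrite ler_norml => /andP[]; lra.
Qed.

Lemma volterra_fixpoint_cvg :
  a t @[t --> +oo] --> (1 : R) /\ weighted_tail a t @[t --> +oo] --> (0 : R).
Proof.
have [_ [C aC]] := abc.
have zbc := bounded_continuous_cst (0 : R).
have N0 (k : R) : k * tail (fun s => `|W s|) t @[t --> +oo] --> (0 : R).
  rewrite -[X in _ --> X](mulr0 k); apply: cvgM; first exact: cvg_cst.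
  by apply: tail_cvg0 => //; exact: integrable_norm.
split.
  apply/cvgrPdist_le => e e0.
  move/cvgrPdist_le: (N0 (c^-1 * C)) => /(_ _ e0) H.
  near=> t.
  have t0 : 0 <= t by near: t; apply: nbhs_pinfty_ge; rewrite num_real.
  rewrite distrC fix_a// -[X in _ - X](volterra_op0 t).
  apply: (le_trans (volterra_opB_le (C := C) abc zbc t0 _)).
    by move=> s _; rewrite subr0.
  rewrite mulrA; apply: (le_trans (ler_norm _)).
  by rewrite -normrN -sub0r; near: t.
apply/cvgrPdist_le => e e0.
move/cvgrPdist_le: (N0 C) => /(_ _ e0) H.
near=> t.
have t0 : 0 <= t by near: t; apply: nbhs_pinfty_ge; rewrite num_real.
rewrite sub0r normrN; apply: (le_trans (weighted_tail_le abc t0 aC)).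
apply: (le_trans (ler_norm _)).
by rewrite -normrN -sub0r; near: t.
Unshelve. all: by end_near. Qed.

End fixpoint.

End volterra.

(** * The potential, and assembly of the theorem *)

Lemma potential_continuous (R : realType) (b m : R -> R) :
  hC 1 b -> hC 0 m -> {within halfline, continuous (potential b m)}.
Proof.
move=> [_ cb] [_ cm] x.
have c0 : {within halfline, continuous b} := cb 0%N isT.
have c1 : {within halfline, continuous (hderive b)} := cb 1%N isT.
have c2 : {within halfline, continuous m} := cm 0%N isT.
rewrite /potential; apply: cvgB.
  apply: cvgB; first exact: c2.
  by apply: cvgM; [exact: cvg_cst|exact: c1].
apply: cvgM; first exact: cvg_cst.
by rewrite expr2; apply: cvgM; exact: c0.
Qed.

(** The class L^1 lives on the open half-line and [tail] on closed ones; the point 0 is null, so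
    integrability and norm pass from one to the other. *)
Lemma hLfun1_halfline (R : realType) (V W : R -> R) :
  hLfun 1%E V -> continuous W -> (forall t, 0 <= t -> V t = W t) ->
  (@lebesgue_measure R).-integrable halfline (EFin \o W) /\
  tail (fun s => `|W s|) 0 = hL1norm V.
Proof.
set mu := lebesgue_measure.
move=> /Lfun1_integrable; rewrite -restrict_EFin => VL1 cW VW.
have mo : measurable (@open_halfline R) by exact: measurable_itv.
have iV := (@integrable_mkcond _ _ R mu _ (EFin \o V) mo).2 VL1.
have iW : mu.-integrable open_halfline (EFin \o W).
  apply: eq_integrable iV => // x.
  rewrite inE /open_halfline/= in_itv/= andbT => x0.
  by rewrite VW// ltW.
have mW (D : set R) : measurable_fun D (EFin \o (fun s => `|W s|)).
  apply/measurable_EFinP; apply: measurable_funTS.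
  by apply: measurableT_comp => //; exact: continuous_measurable_fun.
have oc : (\int[mu]_(x in open_halfline) (`|W x|)%:E =
           \int[mu]_(x in halfline) (`|W x|)%:E)%E.
  by rewrite /open_halfline /halfline integral_itv_obnd_cbnd.
split.
  apply/integrableP; split.
    apply/measurable_EFinP/measurable_funTS.
    exact: continuous_measurable_fun.
  by rewrite -oc; case/integrableP: iW.
rewrite /tail /Rintegral -/halfline -oc /hL1norm Lnorm1 -restrict_EFin.
congr fine; rewrite [LHS]integral_mkcond; apply: eq_integral => x _.
rewrite !patchE; case: ifPn => [|_]; last by rewrite /= normr0.
rewrite inE /open_halfline/= in_itv/= andbT => x0.
by rewrite VW// ltW.
Qed.

Theorem proposition3p2 (R : realType) (b m : R -> R) (eta : R)
  (V := potential b m)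
  (b_C1 : hC 1 b) (b_Linfty : hLfun +oo%E b) (m_C0 : hC 0 m)
  (V_L1 : hLfun 1%E V)
  (eta_ge : Num.max 1 (16 * hL1norm V) <= eta) :
  exists a : R -> R,
    [/\ hCb a /\ volterra_eq V eta a,
        forall a' : R -> R, hCb a' -> volterra_eq V eta a' ->
          forall t : R, 0 <= t -> a' t = a t,
        hC 2 a /\ (forall t : R, 0 <= t -> 30 / 31 <= a t <= 32 / 31),
        forall t : R, 0 <= t ->
          hderive (hderive a) t - 2 * eta * hderive a t + V t * a t = 0
      & (a t @[t --> +oo] --> (1 : R)) /\
        (hderive a t @[t --> +oo] --> (0 : R))].
Proof.
pose c := 2 * eta.
have [eta1 etaM] : 1 <= eta /\ 16 * hL1norm V <= eta.
  by move: eta_ge; rewrite ge_max => /andP[].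
have c0 : 0 < c by rewrite /c; lra.
pose W (t : R) := V (Num.max t 0).
have VW (t : R) : 0 <= t -> V t = W t by move=> t0; rewrite /W max_l.
have cV : {within halfline, continuous V} by exact: potential_continuous.
have cW : continuous W := continuous_comp_maxr0 cV.
have [iW NW] := hLfun1_halfline V_L1 cW VW.
have cM : 32 * hL1norm V <= c by rewrite /c; lra.
have NM : tail (fun s => `|W s|) 0 <= hL1norm V by rewrite NW.
(* Two functions are kept apart because a competitor [a'] is arbitrary at negative points: [f] will
   be [a'], and [g] its constant extension to the left. For existence both are [a]. *)
have eqV (f g : R -> R) : bounded_continuous g ->
    (forall t, 0 <= t -> f t = g t) ->
    volterra_eq V eta f <-> forall t, 0 <= t -> g t = volterra_op W c g t.
  move=> gbc fg.
  have key (t : R) : 0 <= t -> 1 - (2 * eta)^-1 *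
      \int[lebesgue_measure]_(s in `[t, +oo[)
        ((1 - expR (- (2 * eta * (s - t)))) * V s * f s) = volterra_op W c g t.
    move=> t0; rewrite volterra_opE//.
    congr (_ - _ * _); apply: eq_Rintegral => s.
    rewrite inE/= in_itv/= andbT => ts; have s0 := le_trans t0 ts.
    by rewrite VW// fg.
  split=> fV t t0; first by rewrite -key// -fV// fg.
  by rewrite key// fg// fV.
have [a abc fix_a] := volterra_fixpoint_exists cW iW NM c0 cM.
have dera (t : R) : 0 <= t ->
    hderivable a t /\ hderive a t = weighted_tail W c a t.
  move=> t0; apply: (hderivableE t0 fix_a).
  by have [] := volterra_op_is_derive cW iW c0 abc t0.
have dera2 (t : R) : 0 <= t -> hderivable (hderive a) t /\
    hderive (hderive a) t = c * weighted_tail W c a t - W t * a t.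
  move=> t0; apply: (hderivableE (F := weighted_tail W c a)) => //.
    by move=> s /dera[].
  by have [] := volterra_op_is_derive cW iW c0 abc t0.
have cw (t : R) : 0 <= t -> {for t, continuous (weighted_tail W c a)}.
  move=> t0; have [_ [d _]] := volterra_op_is_derive cW iW c0 abc t0.
  by apply: differentiable_continuous; apply/derivable1_diffP.
have [ca [C aC]] := abc.
have cah : {within halfline, continuous a} by exact: continuous_subspaceT.
have [lim1 lim0] := volterra_fixpoint_cvg cW iW c0 abc fix_a.
exists a; split.
- split; last by apply/(eqV a a abc).
  split => //; exists C; split; first exact: num_real.
  by move=> x Cx t _; apply: le_trans (aC t) _; exact: ltW.
- move=> a' [ca' [D [_ HD]]] va' t t0.
  have a'bc : bounded_continuous (fun t => a' (Num.max t 0)).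
    split; first exact: continuous_comp_maxr0.
    (* [bounded] provides a bound for every constant strictly above [D], hence [D + 1]. *)
    exists (D + 1) => s; apply: (HD (D + 1)); first by rewrite ltrDl.
    by rewrite /halfline/= in_itv/= andbT le_max lexx orbT.
  have a'E s : 0 <= s -> a' s = a' (Num.max s 0) by move=> s0; rewrite max_l.
  rewrite a'E//.
  apply: (volterra_fixpoint_unique cW iW NM c0 cM abc a'bc fix_a _ t0).
  by apply/(eqV a').
- split; last first.
    move=> t; exact: (volterra_fixpoint_bounds cW iW NM c0 cM abc fix_a).
  split.
    by move=> [|[|//]] t _ t0; [have [] := dera t t0|have [] := dera2 t t0].
  move=> [|[|[|//]]] _ //.
    by apply: (within_halfline_continuous _ cw) => s /dera[].
  apply: (within_halfline_continuous
    (F := fun t => c * weighted_tail W c a t - W t * a t)).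
    by move=> s /dera2[].
  move=> t t0; apply: cvgB.
    by apply: cvgM; [exact: cvg_cst|exact: cw].
  by apply: cvgM; [exact: cW|exact: ca].
- move=> t t0; rewrite (dera2 t t0).2 (dera t t0).2 VW// -/c; ring.
- split => //.
  (* [hderive a] is known to equal [weighted_tail] only for [t >= 0], which holds eventually. *)
  apply: cvg_trans lim0; apply: near_eq_cvg; near=> t.
  have t0 : 0 <= t by near: t; apply: nbhs_pinfty_ge; rewrite num_real.
  by rewrite (dera t t0).2.
Unshelve. all: by end_near. Qed.
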